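(* Consider the control system $\dot x=f(x)+g(x)u$ with $x\in\mathbb{R}^n$, $u\in U=\mathbb{R}^m$. Let $V$ be a control Lyapunov function (CLF) for this system with the derivative of $V$ locally Lipschitz continuous, and let $c>0$ be a constant. Assume that the vector fields $f$ and $g$ are both locally Lipschitz continuous and that $h:\mathcal{D}\to\mathbb{R}$ is a locally Lipschitz continuous zeroing control barrier function (ZCBF), with associated extended class $\mathcal{K}$ function $\alpha$. Suppose furthermore that the relative degree one condition, $L_gh(x)\neq0$ for all $x\in\mathcal{D}$, holds. For $x\in\mathcal{D}$ let $\mathbf{u}^*(x)\in\mathbb{R}^{m+1}$ be the solution of the quadratic program $$\mathbf{u}^*(x)=\underset{\mathbf{u}=[u^\top,\delta]^\top\in\mathbb{R}^{m+1}}{\operatorname{argmin}}\;\mathbf{u}^\top\mathbf{u}$$ subject to $$L_gV(x)u+L_fV(x)+cV(x)-\delta\le0,$$ $$L_gh(x)u+L_fh(x)+\alpha(h(x))\ge0,$$ where $u\in\mathbb{R}^m$ and $\delta\in\mathbb{R}$. Then $\mathbf{u}^*(x)$ is locally Lipschitz continuous for $x\in\mathcal{D}$.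
   Context: Here $f:\mathbb{R}^n\to\mathbb{R}^n$, $g:\mathbb{R}^n\to\mathbb{R}^{n\times m}$, and for a differentiable function $W$, $L_fW(x)=\frac{\partial W}{\partial x}(x)f(x)\in\mathbb{R}$, $L_gW(x)=\frac{\partial W}{\partial x}(x)g(x)\in\mathbb{R}^{1\times m}$. Locally Lipschitz: a function $F$ is locally Lipschitz continuous at a point $x$ if there exist $\delta_0,M>0$ such that $\|F(x)-F(x')\|\le M\|x-x'\|$ for all $\|x-x'\|\le\delta_0$; statements on a set are understood with points in that set and in the usual sense (Lipschitz on a neighborhood of each point). CLF: control Lyapunov function in the usual sense, a continuously differentiable real-valued function $V$ of the state; its associated set of stabilizing control inputs is $K_{\mathrm{clf}}(x)=\{u\in\mathbb{R}^m: L_fV(x)+L_gV(x)u+cV(x)<0\}$. The scalar $\delta$ in the quadratic program is a relaxation parameter for the CLF inequality. Extended class $\mathcal{K}$: a continuous function $\beta:(-b,a)\to(-\infty,\infty)$, for some $a,b>0$, that is strictly increasing with $\beta(0)=0$. ZCBF: let $h$ be a continuously differentiable real-valued function on $\mathbb{R}^n$ and let $\mathcal{C}=\{x: h(x)\ge0\}$, with $\partial\mathcal{C}=\{x:h(x)=0\}$ and $\mathrm{Int}(\mathcal{C})=\{x:h(x)>0\}$. The function $h$ is a ZCBF defined on a set $\mathcal{D}$ with $\mathcal{C}\subseteq\mathcal{D}\subset\mathbb{R}^n$ if there exists an extended class $\mathcal{K}$ function $\alpha$ such that $\sup_{u\in U}\left[L_fh(x)+L_gh(x)u+\alpha(h(x))\right]\ge0$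 for all $x\in\mathcal{D}$ (it is implicit that $h(x)$ lies in the domain of $\alpha$ for $x\in\mathcal{D}$). The ZCBF $h$ is said to be locally Lipschitz continuous if $\alpha$ and the derivative of $h$ are both locally Lipschitz continuous. *)

(* Defs.v *)
From HB Require Import structures.
From mathcomp Require Import all_boot all_order all_algebra.
From mathcomp Require Import all_classical all_reals all_analysis.

Set Implicit Arguments.
Unset Strict Implicit.
Unset Printing Implicit Defensive.

Import Order.TTheory GRing.Theory Num.Theory.
Import numFieldNormedType.Exports.

Local Open Scope classical_set_scope.
Local Open Scope ring_scope.

(* Matrices carry the library's sup norm; being equivalent to the Euclidean
   norm, it gives the same locally Lipschitz maps. The neighborhood is
   intersected with A, so that A need not be open. *)
Definition locally_lipschitz (R : realType) (E F : normedModType R)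
    (A : set E) (G : E -> F) : Prop :=
  forall x, A x -> exists2 B, nbhs x B & [lipschitz G y | y in A `&` B].

Section ControlSystem.
Variables (R : realType) (n m : nat).
Variables (f : 'cV[R]_n -> 'cV[R]_n) (g : 'cV[R]_n -> 'M[R]_(n, m)).
Implicit Types (W V h : 'cV[R]_n -> R) (x : 'cV[R]_n) (u : 'cV[R]_m).
Implicit Types (alpha : R -> R) (a b : \bar R).

Definition deriv_row W x : 'rV[R]_n := \row_j 'D_(delta_mx j 0) W x.

Definition cont_diff W : Prop :=
  (forall x, differentiable W x) /\ continuous (deriv_row W).

Definition Lf W x : R := (deriv_row W x *m f x) 0 0.

Definition Lg W x : 'rV[R]_m := deriv_row W x *m g x.

(* The equilibrium to be stabilized is the origin. Properness of V, which is
   sometimes also required, is not. *)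
Definition is_clf V : Prop :=
  [/\ cont_diff V,
      V 0 = 0,
      (forall x, x != 0 -> 0 < V x) &
      forall x, x != 0 -> exists u, Lf V x + (Lg V x *m u) 0 0 < 0].

(* The interval (-b, a). Its bounds are extended reals, so that class K
   functions on unbounded intervals are included. *)
Definition K_dom a b : set R := [set s | (- b < s%:E)%E /\ (s%:E < a)%E].

(* alpha only matters on (-b, a); outside it is an arbitrary total extension. *)
Definition ext_class_K a b alpha : Prop :=
  [/\ (0 < a)%E, (0 < b)%E,
      {within K_dom a b, continuous alpha},
      (forall s t, K_dom a b s -> K_dom a b t -> s < t -> alpha s < alpha t) &
      alpha 0 = 0].

(* h is a ZCBF on D for the input set U, with alpha as associated function. *)
Definition is_zcbf (U : set 'cV[R]_m) (D : set 'cV[R]_n) h a b alpha : Prop :=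
  [/\ cont_diff h,
      [set x | 0 <= h x] `<=` D,
      ext_class_K a b alpha,
      (forall x, D x -> K_dom a b (h x)) &
      forall x, D x ->
        (0 <= ereal_sup
           [set (Lf h x + (Lg h x *m u) 0 0 + alpha (h x))%:E | u in U])%E].

Definition locally_lipschitz_zcbf U (D : set 'cV[R]_n) h a b alpha : Prop :=
  [/\ is_zcbf U D h a b alpha,
      locally_lipschitz (K_dom a b) alpha &
      locally_lipschitz D (deriv_row h)].

(* The decision variable z stacks u : 'cV_m on top of the scalar delta. *)
Definition qp_feasible V h alpha (c : R) x : set 'cV[R]_(m + 1) :=
  [set z | let u := usubmx z in let delta := dsubmx z 0 0 in
     (Lg V x *m u) 0 0 + Lf V x + c * V x - delta <= 0 /\
     0 <= (Lg h x *m u) 0 0 + Lf h x + alpha (h x)].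

Definition qp_cost (z : 'cV[R]_(m + 1)) : R := (z^T *m z) 0 0.

Definition qp_solution V h alpha c x (z : 'cV[R]_(m + 1)) : Prop :=
  qp_feasible V h alpha c x z /\
  forall y, qp_feasible V h alpha c x y -> qp_cost z <= qp_cost y.

End ControlSystem.

(* Main.v *)
(* The program asks for the point z of minimal norm with a1.z <= b1 and
   a2.z <= b2, where a1 = (LgV, -1), a2 = (-Lgh, 0), b1 = -(LfV + cV) and
   b2 = Lfh + alpha(h). Since Lgh <> 0, the Gram matrix G of (a1, a2) is
   positive definite. The KKT conditions say that z = -(l1 a1 + l2 a2), where
   l >= 0, w = G l + b >= 0 and l.w = 0; a point of this form is the unique
   minimizer. Instead of using a closed form for l, compare the solutions l, l'
   for two data (G, b), (G', b'): complementarity gives (l - l').(w - w') <= 0,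
   hence (l - l').G(l - l') <= -(l - l').((G - G')l' + b - b'), and the local
   lower bound on G makes l, and then z, locally Lipschitz in the data. *)
Require Import Defs.
From mathcomp Require Import all_boot all_order all_algebra.
From mathcomp Require Import all_classical all_reals all_analysis.
From mathcomp Require Import ring lra.
Import Order.TTheory GRing.Theory Num.Theory.
Import numFieldNormedType.Exports.
Local Open Scope classical_set_scope.
Local Open Scope ring_scope.

Set Implicit Arguments.
Unset Strict Implicit.
Unset Printing Implicit Defensive.

(** * Calculus of locally Lipschitz maps *)

Lemma mx_norm_leP (R : realType) (m n : nat) (M : 'M[R]_(m, n)) (k : R) :
  0 <= k -> `|M| <= k <-> forall i j, `|M i j| <= k.
Proof.
move=> k0; rewrite -[`|M|]/(mx_norm M) mx_normrE; split.
  by move=> /bigmax_leP[_ Mk] i j; exact: (Mk (i, j)).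
by move=> Mk; apply/bigmax_leP; split=> // -[i j].
Qed.

Lemma mx_norm_entry (R : realType) (m n : nat) (M : 'M[R]_(m, n)) i j :
  `|M i j| <= `|M|.
Proof. exact: (mx_norm_leP M (normr_ge0 _)).1. Qed.

(** With a filter on pairs, estimates for several maps combine by [filterS2] instead of by
    intersecting neighborhoods by hand. *)
Lemma locally_lipschitzP (R : realType) (E F : normedModType R) (A : set E)
    (G : E -> F) :
  locally_lipschitz A G <->
  forall x, A x -> exists k, \forall y & z \near x,
    A y -> A z -> `|G y - G z| <= k * `|y - z|.
Proof.
split=> GA x Ax.
  (* [[lipschitz _ | _]] asserts the estimate for all large constants, so [k] is a strict threshold
     and [k + 1] lies above it. *)
  have [B Bx [k [_ kG]]] := GA x Ax; exists (k + 1), (B, B) => //.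
  move=> [y z] [/= By Bz] Ay Az.
  exact: (kG (k + 1) (ltr_pwDr ltr01 (lexx k)) (y, z)).
have [k [[B C] /= [Bx Cx] BCk]] := GA x Ax.
exists (B `&` C); first exact: filterI.
apply: (@klipschitzW _ _ _ k).
  exact: (@globally_properfilter _ _ (x, x)
    (conj (conj Ax (conj (nbhs_singleton Bx) (nbhs_singleton Cx)))
          (conj Ax (conj (nbhs_singleton Bx) (nbhs_singleton Cx))))).
by move=> [y z] [[Ay [By _]] [Az [_ Cz]]]; exact: (BCk (y, z)).
Qed.

Lemma near_pair (T : topologicalType) (x : T) (P : set T) :
  (\forall y \near x, P y) -> \forall y & z \near x, P y /\ P z.
Proof. by move=> Px; exists (P, P). Qed.

Lemma locally_lipschitz_near (R : realType) (E F : normedModType R)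
    (A : set E) (G : E -> F) (x : E) (e : R) :
  locally_lipschitz A G -> A x -> 0 < e ->
  \forall y \near x, A y -> `|G y - G x| < e.
Proof.
move=> /locally_lipschitzP GA Ax e0.
have [k [[B C] /= [Bx Cx] BCk]] := GA x Ax.
(* The constant [k] may be zero or negative, whereas [|k| + 1] can be divided by. *)
have k1 : 0 < `|k| + 1 by rewrite ltr_wpDl.
have d0 : 0 < e / (`|k| + 1) by rewrite divr_gt0.
apply: filterS (filterI Bx (nbhsx_ballx x _ d0)) => y [By].
rewrite -ball_normE /= distrC => xye Ay.
apply: (le_lt_trans (BCk (y, x) (conj By (nbhs_singleton Cx)) Ay Ax)) => /=.
have le1 : k * `|y - x| <= (`|k| + 1) * `|y - x|.
  rewrite ler_wpM2r // (le_trans (ler_norm _)) // lerDl //.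
by apply: (le_lt_trans le1); rewrite mulrC -ltr_pdivlMr.
Qed.

(** One constant doubles as local bound and Lipschitz constant, which keeps the estimates for
    products, inverses and compositions short. *)
Lemma locally_lipschitz_bounded (R : realType) (E F : normedModType R)
    (A : set E) (G : E -> F) (x : E) :
  locally_lipschitz A G -> A x ->
  exists2 k, 0 <= k & \forall y & z \near x, A y -> A z ->
    [/\ `|G y| <= k, `|G z| <= k & `|G y - G z| <= k * `|y - z|].
Proof.
move=> GA Ax.
have [k kG] := (locally_lipschitzP A G).1 GA x Ax.
exists (`|G x| + 1 + `|k|); first by rewrite !addr_ge0.
apply: filterS2 kG (near_pair (locally_lipschitz_near GA Ax ltr01)).
move=> [y z] /= kG [Gy Gz] Ay Az.
have bound w : `|G w - G x| < 1 -> `|G w| <= `|G x| + 1 + `|k|.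
  move=> Gw; rewrite -[G w](subrK (G x)).
  apply: (le_trans (ler_normD _ _)).
  by rewrite addrC -addrA lerD2l (le_trans (ltW Gw)) // lerDl.
split; [exact: bound (Gy Ay) | exact: bound (Gz Az) |].
apply: (le_trans (kG Ay Az)); rewrite ler_wpM2r //.
by rewrite (le_trans (ler_norm k)) // lerDr addr_ge0.
Qed.

Lemma eq_locally_lipschitz (R : realType) (E F : normedModType R) (A : set E)
    (G H : E -> F) :
  {in A, G =1 H} -> locally_lipschitz A G -> locally_lipschitz A H.
Proof.
move=> GH /locally_lipschitzP GA; apply/locally_lipschitzP => x Ax.
have [k kG] := GA x Ax; exists k; apply: filterS kG => -[y z] /= kG Ay Az.
by rewrite -!GH ?inE //; exact: kG.
Qed.

Lemma locally_lipschitzS (R : realType) (E F : normedModType R) (A B : set E)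
    (G : E -> F) :
  A `<=` B -> locally_lipschitz B G -> locally_lipschitz A G.
Proof.
move=> AB /locally_lipschitzP GB; apply/locally_lipschitzP => x Ax.
have [k kG] := GB x (AB x Ax); exists k; apply: filterS kG => -[y z] /= kG Ay Az.
by apply: kG; exact: AB.
Qed.

Lemma locally_lipschitz_cst (R : realType) (E F : normedModType R) (A : set E)
    (v : F) : locally_lipschitz A (fun=> v).
Proof.
apply/locally_lipschitzP => x _; exists 0.
exists (setT, setT); first by split; exact: filterT.
by move=> [y z] _ _ _; rewrite subrr normr0 mul0r.
Qed.

Lemma locally_lipschitzD (R : realType) (E F : normedModType R) (A : set E)
    (G H : E -> F) :
  locally_lipschitz A G -> locally_lipschitz A H ->
  locally_lipschitz A (fun x => G x + H x).
Proof.
move=> /locally_lipschitzP GA /locally_lipschitzP HA.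
apply/locally_lipschitzP => x Ax.
have [[k kG] [l lH]] := (GA x Ax, HA x Ax); exists (k + l).
apply: filterS2 kG lH => -[y z] /= kG lH Ay Az.
rewrite opprD addrACA mulrDl (le_trans (ler_normD _ _)) // lerD //.
  exact: kG.
exact: lH.
Qed.

Lemma locally_lipschitzM (R : realType) (E : normedModType R) (A : set E)
    (G H : E -> R) :
  locally_lipschitz A G -> locally_lipschitz A H ->
  locally_lipschitz A (fun x => G x * H x).
Proof.
move=> GA HA; apply/locally_lipschitzP => x Ax.
have [k k0 kG] := locally_lipschitz_bounded GA Ax.
have [l l0 lH] := locally_lipschitz_bounded HA Ax.
exists (k * l + l * k).
apply: filterS2 kG lH => -[y z] /= kG lH Ay Az.
have [[_ Gz Gyz] [Hy _ Hyz]] := (kG Ay Az, lH Ay Az).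
have -> : G y * H y - G z * H z = (G y - G z) * H y + G z * (H y - H z) by ring.
rewrite (le_trans (ler_normD _ _)) // !normrM mulrDl lerD //.
  by rewrite mulrAC ler_pM.
by rewrite [l * k]mulrC -mulrA ler_pM.
Qed.

Lemma locally_lipschitzN (R : realType) (E : normedModType R) (A : set E)
    (G : E -> R) :
  locally_lipschitz A G -> locally_lipschitz A (fun x => - G x).
Proof.
move=> GA; apply: (eq_locally_lipschitz
  (G := fun x => -1 * G x)); first by move=> x _; rewrite mulN1r.
by apply: locally_lipschitzM GA; exact: locally_lipschitz_cst.
Qed.

Lemma locally_lipschitz_sum (R : realType) (E : normedModType R) (A : set E)
    (I : finType) (G : I -> E -> R) :
  (forall i, locally_lipschitz A (G i)) ->
  locally_lipschitz A (fun x => \sum_i G i x).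
Proof.
move=> GA; elim: (index_enum I) => [|i s IHs].
  apply: (eq_locally_lipschitz (G := fun=> 0)); last first.
    exact: locally_lipschitz_cst.
  by move=> x _; rewrite big_nil.
apply: (eq_locally_lipschitz (G := fun x => G i x + \sum_(j <- s) G j x)).
  by move=> x _; rewrite big_cons.
exact: locally_lipschitzD.
Qed.

(** The sup norm splits the matrix estimate into finitely many scalar ones; the sum of the
    nonnegative entrywise constants serves every entry. *)
Lemma locally_lipschitz_mxP (R : realType) (E : normedModType R) (A : set E)
    (m n : nat) (G : E -> 'M[R]_(m, n)) :
  locally_lipschitz A G <->
  forall i j, locally_lipschitz A (fun x => G x i j).
Proof.
split=> [/locally_lipschitzP GA i j|GA].
  apply/locally_lipschitzP => x Ax; have [k kG] := GA x Ax; exists k.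
  apply: filterS kG => -[y z] /= kG Ay Az.
  apply: le_trans (kG Ay Az).
  by have := mx_norm_entry (G y - G z) i j; rewrite !mxE.
apply/locally_lipschitzP => x Ax.
have {}GA (p : 'I_m * 'I_n) : exists k : R, 0 <= k /\ \forall y & z \near x,
    A y -> A z -> `|G y p.1 p.2 - G z p.1 p.2| <= k * `|y - z|.
  have [k k0 kG] := locally_lipschitz_bounded (GA p.1 p.2) Ax.
  exists k; split=> //; apply: filterS kG => -[y z] /= kG Ay Az.
  by have [] := kG Ay Az.
have [k kG] := choice GA.
have k0 p : 0 <= k p by have [] := kG p.
have ks p : k p <= \sum_q k q.
  by rewrite (bigD1 p) //= lerDl sumr_ge0.
exists (\sum_p k p).
have kG_near := filter_forall (nbhs_filter (x, x)) (fun p => (kG p).2).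
apply: filterS kG_near => -[y z] /= {}kG Ay Az.
apply/mx_norm_leP => [|i j].
  by rewrite mulr_ge0 // sumr_ge0.
rewrite !mxE (le_trans (kG (i, j) Ay Az)) // ler_wpM2r //; exact: ks.
Qed.

Lemma locally_lipschitz_mulmx (R : realType) (E : normedModType R) (A : set E)
    (m n p : nat) (G : E -> 'M[R]_(m, n)) (H : E -> 'M[R]_(n, p)) :
  locally_lipschitz A G -> locally_lipschitz A H ->
  locally_lipschitz A (fun x => G x *m H x).
Proof.
move=> /locally_lipschitz_mxP GA /locally_lipschitz_mxP HA.
apply/locally_lipschitz_mxP => i k.
apply: (eq_locally_lipschitz (G := fun x => \sum_j G x i j * H x j k)).
  by move=> x _; rewrite mxE.
by apply: locally_lipschitz_sum => j; exact: locally_lipschitzM.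
Qed.

(** Continuity of [u] brings nearby points of [A] into a ball around [u x] where the estimate for
    [v] holds. Confining the values of [u] to [B] allows an outer map controlled only on an
    interval, such as [alpha]. *)
Lemma locally_lipschitz_comp (R : realType) (E F H : normedModType R)
    (A : set E) (B : set F) (u : E -> F) (v : F -> H) :
  (forall x, A x -> B (u x)) -> locally_lipschitz A u ->
  locally_lipschitz B v -> locally_lipschitz A (v \o u).
Proof.
move=> AB uA /locally_lipschitzP vB; apply/locally_lipschitzP => x Ax.
have [k [[P Q] /= [Px Qx] kv]] := vB (u x) (AB x Ax).
have [l l0 lu] := locally_lipschitz_bounded uA Ax.
have [e /= e0 ePQ] := (nbhs_ballP _ _).1 (filterI Px Qx).
have ux := near_pair (locally_lipschitz_near uA Ax e0).
exists (`|k| * l); apply: filterS2 lu ux => -[y z] /= lu [uy uz] Ay Az.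
have [_ _ luyz] := lu Ay Az.
have PQy : (P `&` Q) (u y) by apply: ePQ; rewrite -ball_normE /= distrC uy.
have PQz : (P `&` Q) (u z) by apply: ePQ; rewrite -ball_normE /= distrC uz.
apply: (le_trans (kv (u y, u z) (conj PQy.1 PQz.2) (AB y Ay) (AB z Az))) => /=.
apply: (@le_trans _ _ (`|k| * `|u y - u z|)).
  by rewrite ler_wpM2r // ler_norm.
by rewrite -mulrA ler_wpM2l.
Qed.

(** * Lipschitz bounds for continuously differentiable functions and for reciprocals *)

Lemma diff_deriv_row (R : realType) (n : nat) (W : 'cV[R]_n -> R) x v :
  differentiable W x -> 'd W x v = (deriv_row W x *m v) 0 0.
Proof.
move=> dW.
have vE : v = \sum_j v j 0 *: delta_mx j 0.
  by rewrite {1}(matrix_sum_delta v); apply: eq_bigr => j _; rewrite big_ord1.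
rewrite {1}vE linear_sum mxE; apply: eq_bigr => j _.
by rewrite linearZ /= mxE deriveE // mulrC.
Qed.

Lemma ler_norm_mulmx (R : realType) (n : nat) (p : 'rV[R]_n) (v : 'cV[R]_n) :
  `|(p *m v) 0 0| <= n%:R * `|p| * `|v|.
Proof.
rewrite mxE (le_trans (ler_norm_sum _ _ _)) //.
apply: (@le_trans _ _ (\sum_(j < n) `|p| * `|v|)).
  by apply: ler_sum => j _; rewrite normrM ler_pM ?mx_norm_entry.
by rewrite sumr_const card_ord -mulrA mulr_natl.
Qed.

(** The derivative is bounded near [x] by continuity, and the mean value theorem on the segment from
    [z] to [y] turns this bound into a Lipschitz constant. The factor [n] comes from pairing a row
    and a column in sup norms. *)
Lemma cont_diff_locally_lipschitz (R : realType) (n : nat)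
    (W : 'cV[R]_n -> R) (A : set 'cV[R]_n) :
  cont_diff W -> locally_lipschitz A W.
Proof.
move=> [dW cW]; apply/locally_lipschitzP => x _.
pose K := `|deriv_row W x| + 1.
have : \forall y \near x, `|deriv_row W y| <= K.
  have /cvgrPdist_lt /(_ 1 ltr01) := cW x.
  apply: filterS => y Wy; rewrite -[deriv_row W y](subrK (deriv_row W x)).
  by rewrite (le_trans (ler_normD _ _)) // addrC lerD2l distrC ltW.
move=> /nbhs_ballP[e /= e0 eK].
exists (n%:R * K).
apply: filterS (near_pair (nbhsx_ballx x _ e0)) => -[y z] /=.
rewrite -ball_normE /= => -[xy xz] _ _.
pose phi (t : R) := W (z + t *: (y - z)).
pose dphi (t : R) := (deriv_row W (z + t *: (y - z)) *m (y - z)) 0 0.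
have phi_deriv (t : R) : is_derive t 1 phi (dphi t).
  pose s (r : R) := z + r *: (y - z).
  have ds : is_diff t s (fun r => r *: (y - z)).
    by apply: is_diff_eq; rewrite add0r.
  have dWs : differentiable (W \o s) t.
    by apply: differentiable_comp => //; exact: (dW _).
  apply: DeriveDef; first by apply/derivable1_diffP.
  rewrite deriveE // diff_comp /= ?diff_val //.
  by rewrite scale1r diff_deriv_row.
have [|t t01] := @MVT R phi dphi 0 1 ltr01.
  by apply: derivable_within_continuous => t _; have [] := phi_deriv t.
rewrite /phi scale1r scale0r addr0 subr0 mulr1 [z + _]addrC subrK => ->.
apply: le_trans (ler_norm_mulmx _ _) _.
rewrite ler_wpM2r // ler_wpM2l // eK // -ball_normE /=.
(* The ball is convex, so the intermediate point stays where the derivative is bounded. *)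
have -> : x - (z + t *: (y - z)) = t *: (x - y) + (1 - t) *: (x - z).
  by apply/matrixP => i j; rewrite !mxE; ring.
move: t01; rewrite in_itv /= => /andP[t0 t1].
rewrite (le_lt_trans (ler_normD _ _)) // !normrZ !gtr0_norm ?subr_gt0 //.
have : t * `|x - y| < t * e by rewrite ltr_pM2l.
have : (1 - t) * `|x - z| < (1 - t) * e by rewrite ltr_pM2l ?subr_gt0.
lra.
Qed.

Lemma locally_lipschitzV (R : realType) (E : normedModType R) (A : set E)
    (G : E -> R) :
  (forall x, A x -> G x != 0) -> locally_lipschitz A G ->
  locally_lipschitz A (fun x => (G x)^-1).
Proof.
move=> G_neq0 GA; apply/locally_lipschitzP => x Ax.
(* Values of [G] within [d] of [G x] have modulus at least [d]; hence the denominator [d ^+ 2] in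
   the constant. *)
pose d := `|G x| / 2.
have d0 : 0 < d by rewrite divr_gt0 // normr_gt0 G_neq0.
have [k k0 kG] := locally_lipschitz_bounded GA Ax.
exists (k / d ^+ 2).
have Gd := near_pair (locally_lipschitz_near GA Ax d0).
apply: filterS2 kG Gd => -[y z] /= kG [Gy Gz] Ay Az.
have lower w : `|G w - G x| < d -> d <= `|G w|.
  have : `|G x| <= `|G x - G w| + `|G w|.
    by rewrite -{1}[G x](subrK (G w)) ler_normD.
  rewrite distrC /d; lra.
have {}Gy := lower y (Gy Ay); have {}Gz := lower z (Gz Az).
have -> : (G y)^-1 - (G z)^-1 = - ((G y - G z) / (G y * G z)).
  by field; rewrite !G_neq0.
have [_ _ Gyz] := kG Ay Az.
rewrite normrN normrM normfV normrM mulrAC ler_pM ?invr_ge0 ?mulr_ge0 //.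
rewrite lef_pV2 ?posrE ?exprn_gt0 ?mulr_gt0 ?normr_gt0 ?G_neq0 //.
by rewrite expr2 ler_pM // ltW.
Qed.

(** * Linear complementarity problems of size two *)

(* The linear complementarity problem for the matrix [[p, q], [q, r]]. *)
Definition lcp2 (R : realType) (p q r b1 b2 l1 l2 : R) : Prop :=
  [/\ 0 <= l1 /\ 0 <= l2, 0 <= p * l1 + q * l2 + b1,
      0 <= q * l1 + r * l2 + b2, l1 * (p * l1 + q * l2 + b1) = 0 &
      l2 * (q * l1 + r * l2 + b2) = 0].

Lemma lcp2_exists (R : realType) (p q r b1 b2 : R) :
  0 < p -> 0 < p * r - q ^+ 2 -> exists l1 l2, lcp2 p q r b1 b2 l1 l2.
Proof.
move=> p0 det0.
have r0 : 0 < r.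
  rewrite -(pmulr_rgt0 _ p0); apply: lt_le_trans det0 _.
  by rewrite gerBl sqr_ge0.
have neg u v : 0 < v -> u <= 0 -> 0 <= - u / v.
  by move=> v0 u0; rewrite mulr_ge0 ?oppr_ge0 // invr_ge0 ltW.
(* [zero], [first] and [second] are the solutions supported on no index, on the first and on the
   second. Their side conditions are the signs of the multiplier and of the remaining slack. *)
have zero : 0 <= b1 -> 0 <= b2 -> exists l1 l2, lcp2 p q r b1 b2 l1 l2.
  by move=> b10 b20; exists 0, 0; split; rewrite ?mulr0 ?mul0r ?add0r.
have first : b1 <= 0 -> 0 <= p * b2 - q * b1 ->
    exists l1 l2, lcp2 p q r b1 b2 l1 l2.
  move=> b10 v0; exists (- b1 / p), 0.
  have E1 : p * (- b1 / p) + q * 0 + b1 = 0 by field; rewrite gt_eqF.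
  have E2 : q * (- b1 / p) + r * 0 + b2 = (p * b2 - q * b1) / p.
    by field; rewrite gt_eqF.
  split; rewrite ?E1 ?E2 ?mulr0 ?mul0r //; first by split=> //; exact: neg.
  by rewrite divr_ge0 // ltW.
have second : b2 <= 0 -> 0 <= r * b1 - q * b2 ->
    exists l1 l2, lcp2 p q r b1 b2 l1 l2.
  move=> b20 u0; exists 0, (- b2 / r).
  have E1 : p * 0 + q * (- b2 / r) + b1 = (r * b1 - q * b2) / r.
    by field; rewrite gt_eqF.
  have E2 : q * 0 + r * (- b2 / r) + b2 = 0 by field; rewrite gt_eqF.
  split; rewrite ?E1 ?E2 ?mulr0 ?mul0r //; first by split=> //; exact: neg.
  by rewrite divr_ge0 // ltW.
(* By Cramer's rule these are the components of the solution of [G l + b = 0], times minus the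
   determinant. If both are nonpositive, that solution is admissible; otherwise the signs of [b1]
   and [b2] select the support. *)
have [u0|u0] := leP (r * b1 - q * b2) 0; have [v0|v0] := leP (p * b2 - q * b1) 0.
- exists (- (r * b1 - q * b2) / (p * r - q ^+ 2)).
  exists (- (p * b2 - q * b1) / (p * r - q ^+ 2)).
  have det_neq0 : p * r - q ^+ 2 != 0 by rewrite gt_eqF.
  set l1 := _ / _; set l2 := _ / _.
  have E1 : p * l1 + q * l2 + b1 = 0 by rewrite /l1 /l2; field.
  have E2 : q * l1 + r * l2 + b2 = 0 by rewrite /l1 /l2; field.
  by split; rewrite ?E1 ?E2 ?mulr0 //; split; exact: neg.
- have [b10|b10] := leP b1 0; first exact: first b10 (ltW v0).
  have [b20|b20] := leP 0 b2; first exact: zero (ltW b10) b20.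
  (* Here [b1 > 0 > b2], so [u0] forces [q < 0]; multiplying [u0] and [v0] gives [p * r < q ^+ 2], a
     contradiction. The mirror case below is refuted the same way. *)
  have : 0 < (p * r - q ^+ 2) * (b1 * - b2).
    by rewrite mulr_gt0 // mulr_gt0 // oppr_gt0.
  have q0 : q < 0 by nra.
  nra.
- have [b20|b20] := leP b2 0; first exact: second b20 (ltW u0).
  have [b10|b10] := leP 0 b1; first exact: zero b10 (ltW b20).
  have : 0 < (p * r - q ^+ 2) * (- b1 * b2).
    by rewrite mulr_gt0 // mulr_gt0 // oppr_gt0.
  have q0 : q < 0 by nra.
  nra.
- have [b10|b10] := leP b1 0; first exact: first b10 (ltW v0).
  have [b20|b20] := leP b2 0; first exact: second b20 (ltW u0).
  exact: zero (ltW b10) (ltW b20).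
Qed.

(** Trace over determinant is the sum of the inverse eigenvalues, so [K] dominates the inverse of
    the smallest one; [e] bounds the perturbation of the data seen at the second solution. The
    second matrix is left arbitrary, which permits the zero problem there. *)
Lemma lcp2_dist (R : realType) (p q r b1 b2 l1 l2 p' q' r' b1' b2' m1 m2 K e : R) :
  0 < p * r - q ^+ 2 -> 0 <= p + r <= K * (p * r - q ^+ 2) ->
  lcp2 p q r b1 b2 l1 l2 -> lcp2 p' q' r' b1' b2' m1 m2 ->
  `|p - p'| * m1 + `|q - q'| * m2 + `|b1 - b1'| <= e ->
  `|q - q'| * m1 + `|r - r'| * m2 + `|b2 - b2'| <= e ->
  `|l1 - m1| + `|l2 - m2| <= 2 * K * e.
Proof.
move=> det0 /andP[tr0 trK] [[l10 l20] wl1 wl2 cl1 cl2] [[m10 m20] wm1 wm2 cm1 cm2].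
set e1 := (X in X <= e -> _); set e2 := (X in _ -> X <= e -> _) => e1e e2e.
set s := l1 - m1; set t := l2 - m2.
pose e1' := (p - p') * m1 + (q - q') * m2 + (b1 - b1').
pose e2' := (q - q') * m1 + (r - r') * m2 + (b2 - b2').
have e1'e : `|e1'| <= e.
  apply: le_trans e1e; rewrite /e1' (le_trans (ler_normD _ _)) // lerD2r.
  by rewrite (le_trans (ler_normD _ _)) // !normrM !(ger0_norm m10, ger0_norm m20).
have e2'e : `|e2'| <= e.
  apply: le_trans e2e; rewrite /e2' (le_trans (ler_normD _ _)) // lerD2r.
  by rewrite (le_trans (ler_normD _ _)) // !normrM !(ger0_norm m10, ger0_norm m20).
(* The products below are the cross terms between each solution and the slack of the other; the
   diagonal terms vanish by complementarity. *)
have monotone : p * s ^+ 2 + 2 * q * s * t + r * t ^+ 2 <= - (s * e1' + t * e2').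
  have := mulr_ge0 l10 wm1; have := mulr_ge0 l20 wm2.
  have := mulr_ge0 m10 wl1; have := mulr_ge0 m20 wl2.
  rewrite /s /t /e1' /e2'; nra.
have bound : - (s * e1' + t * e2') <= (`|s| + `|t|) * e.
  rewrite (le_trans (ler_norm _)) // normrN (le_trans (ler_normD _ _)) //.
  by rewrite !normrM mulrDl lerD // ler_wpM2l.
(* Cayley-Hamilton: tr(G) d.Gd - det(G) |d|^2 = |Gd|^2. *)
have coercive : (p * r - q ^+ 2) * (s ^+ 2 + t ^+ 2) <=
    (p + r) * (p * s ^+ 2 + 2 * q * s * t + r * t ^+ 2).
  have := sqr_ge0 (p * s + q * t); have := sqr_ge0 (q * s + r * t).
  nra.
have K0 : 0 <= K by rewrite -(pmulr_lge0 _ det0) (le_trans tr0).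
have sq : s ^+ 2 + t ^+ 2 <= K * ((`|s| + `|t|) * e).
  rewrite -(ler_pM2l det0) (le_trans coercive) //.
  apply: le_trans (ler_wpM2l tr0 (le_trans monotone bound)) _.
  rewrite [leRHS]mulrA [_ * K]mulrC ler_wpM2r //.
  by rewrite mulr_ge0 ?addr_ge0 // (le_trans _ e1'e).
have [->|st0] := eqVneq (`|s| + `|t|) 0.
  by rewrite !mulr_ge0 // (le_trans _ e1'e).
have st_gt0 : 0 < `|s| + `|t| by rewrite lt_neqAle eq_sym st0 addr_ge0.
(* The factor 2 comes from [(|s| + |t|)^2 <= 2 (s^2 + t^2)]; combined with [sq], one factor
   [|s| + |t|] cancels. *)
rewrite -(ler_pM2l st_gt0).
have := real_normK (num_real s); have := real_normK (num_real t).
have := sqr_ge0 (`|s| - `|t|).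
nra.
Qed.

(** [lcp2_dist] is used twice: first to bound the solutions near [x], then to compare them at two
    nearby points. The ratio [K] is itself locally Lipschitz, hence locally bounded. *)
Lemma lcp2_locally_lipschitz (R : realType) (E : normedModType R) (A : set E)
    (p q r b1 b2 l1 l2 : E -> R) :
  locally_lipschitz A p -> locally_lipschitz A q -> locally_lipschitz A r ->
  locally_lipschitz A b1 -> locally_lipschitz A b2 ->
  (forall x, A x -> 0 < p x) ->
  (forall x, A x -> 0 < p x * r x - q x ^+ 2) ->
  (forall x, A x -> lcp2 (p x) (q x) (r x) (b1 x) (b2 x) (l1 x) (l2 x)) ->
  locally_lipschitz A l1 /\ locally_lipschitz A l2.
Proof.
move=> pA qA rA b1A b2A p0 det0 lA.
pose K x := (p x + r x) / (p x * r x - q x ^+ 2).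
have KA : locally_lipschitz A K.
  apply: locally_lipschitzM; first exact: locally_lipschitzD.
  apply: locally_lipschitzV => [x Ax|]; first by rewrite gt_eqF // det0.
  apply: locally_lipschitzD; first exact: locally_lipschitzM.
  by apply: locally_lipschitzN; exact: locally_lipschitzM.
have trK x : A x -> 0 <= p x + r x <= K x * (p x * r x - q x ^+ 2).
  move=> Ax; rewrite /K divfK ?gt_eqF ?det0 // lexx andbT addr_ge0 // ltW ?p0 //.
  rewrite -(pmulr_rgt0 _ (p0 x Ax)); apply: lt_le_trans (det0 x Ax) _.
  by rewrite gerBl sqr_ge0.
suff lip x : A x -> exists k, \forall y & z \near x, A y -> A z ->
    `|l1 y - l1 z| + `|l2 y - l2 z| <= k * `|y - z|.
  split; apply/locally_lipschitzP => x /lip [k kl]; exists k;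
    apply: filterS kl => -[y z] /= kl Ay Az;
    by rewrite (le_trans _ (kl Ay Az)) // ?lerDl ?lerDr.
move=> Ax.
have [kp kp0 Hp] := locally_lipschitz_bounded pA Ax.
have [kq kq0 Hq] := locally_lipschitz_bounded qA Ax.
have [kr kr0 Hr] := locally_lipschitz_bounded rA Ax.
have [kb1 kb10 Hb1] := locally_lipschitz_bounded b1A Ax.
have [kb2 kb20 Hb2] := locally_lipschitz_bounded b2A Ax.
have [kK kK0 HK] := locally_lipschitz_bounded KA Ax.
(* [k] dominates the constants of all five data and [L] will bound the multipliers. In the final
   constant each [k * L] pays for one matrix entry and the last [k] for the right-hand side. *)
pose k := kp + kq + kr + kb1 + kb2.
pose L := 2 * kK * k.
exists (2 * kK * (k * L + k * L + k)).
apply: filterS2 (filterI Hp (filterI Hq Hr)) (filterI Hb1 (filterI Hb2 HK)).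
move=> [y z] /= [{}Hp [{}Hq {}Hr]] [{}Hb1 [{}Hb2 {}HK]] Ay Az.
have [_ _ {}Hp] := Hp Ay Az.
have [_ _ {}Hq] := Hq Ay Az.
have [_ _ {}Hr] := Hr Ay Az.
have [_ Hb1z {}Hb1] := Hb1 Ay Az.
have [_ Hb2z {}Hb2] := Hb2 Ay Az.
have [Ky Kz _] := HK Ay Az.
(* Comparison with the zero problem bounds the solutions themselves. *)
have lcp0 : lcp2 0 0 0 0 0 0 (0 : R).
  by split; rewrite ?mulr0 ?mul0r ?addr0.
have [[l10 l20] _ _ _ _] := lA z Az.
have lzL : `|l1 z| + `|l2 z| <= L.
  have := lcp2_dist (det0 z Az) (trK z Az) (lA z Az) lcp0 (e := k).
  rewrite !subr0 !mulr0 !add0r => /(_ _ _)/le_trans; apply.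
  - by rewrite (le_trans Hb1z) // /k; lra.
  - by rewrite (le_trans Hb2z) // /k; lra.
  rewrite /L ler_wpM2r //; first by rewrite !addr_ge0.
  by rewrite ler_pM2l // (le_trans (ler_norm _)).
have l1L : l1 z <= L by move: lzL; rewrite !ger0_norm //; lra.
have l2L : l2 z <= L by move: lzL; rewrite !ger0_norm //; lra.
have L0 : 0 <= L := le_trans l10 l1L.
have d0 := normr_ge0 (y - z).
have le_k k' (w : R) : w <= k' * `|y - z| -> k' <= k -> w <= k * `|y - z|.
  by move=> /le_trans wk kk'; apply: wk; rewrite ler_wpM2r.
have Hk k' (w l : R) : `|w| <= k' * `|y - z| -> k' <= k -> 0 <= l <= L ->
    `|w| * l <= k * L * `|y - z|.
  by move=> wk kk' /andP[l0' lL]; rewrite mulrAC ler_pM // (le_k k').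
apply: le_trans (lcp2_dist (det0 y Ay) (trK y Ay) (lA y Ay) (lA z Az)
  (e := (k * L + k * L + k) * `|y - z|) _ _) _.
- rewrite [leRHS]mulrDl [X in _ <= X + _]mulrDl !lerD //.
  + by apply: (Hk _ _ _ Hp); [rewrite /k; lra | rewrite l10].
  + by apply: (Hk _ _ _ Hq); [rewrite /k; lra | rewrite l20].
  + by apply: (le_k _ _ Hb1); rewrite /k; lra.
- rewrite [leRHS]mulrDl [X in _ <= X + _]mulrDl !lerD //.
  + by apply: (Hk _ _ _ Hq); [rewrite /k; lra | rewrite l10].
  + by apply: (Hk _ _ _ Hr); [rewrite /k; lra | rewrite l20].
  + by apply: (le_k _ _ Hb2); rewrite /k; lra.
rewrite -[leRHS]mulrA ler_wpM2r //.
  by rewrite !(mulr_ge0, addr_ge0).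
by rewrite ler_pM2l // (le_trans (ler_norm _)).
Qed.

(** * The Euclidean inner product *)

Definition dot (R : realType) (n : nat) (v w : 'cV[R]_n) : R :=
  \sum_i v i 0 * w i 0.

Lemma dotE (R : realType) (n : nat) (v w : 'cV[R]_n) :
  (v^T *m w) 0 0 = dot v w.
Proof. by rewrite mxE; apply: eq_bigr => i _; rewrite mxE. Qed.

Lemma dotC (R : realType) (n : nat) (v w : 'cV[R]_n) : dot v w = dot w v.
Proof. by apply: eq_bigr => i _; rewrite mulrC. Qed.

Lemma dotDl (R : realType) (n : nat) (u v w : 'cV[R]_n) :
  dot (u + v) w = dot u w + dot v w.
Proof.
by rewrite /dot -big_split; apply: eq_bigr => i _; rewrite mxE mulrDl.
Qed.

Lemma dotZl (R : realType) (n : nat) (s : R) (u w : 'cV[R]_n) :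
  dot (s *: u) w = s * dot u w.
Proof.
by rewrite /dot mulr_sumr; apply: eq_bigr => i _; rewrite mxE mulrA.
Qed.

Lemma dotNl (R : realType) (n : nat) (u w : 'cV[R]_n) :
  dot (- u) w = - dot u w.
Proof. by rewrite -scaleN1r dotZl mulN1r. Qed.

Lemma dot_ge0 (R : realType) (n : nat) (u : 'cV[R]_n) : 0 <= dot u u.
Proof. by apply: sumr_ge0 => i _; exact: sqr_ge0. Qed.

Lemma dot_eq0 (R : realType) (n : nat) (u : 'cV[R]_n) : (dot u u == 0) = (u == 0).
Proof.
apply/eqP/eqP => [uu0|->]; last by apply: big1 => i _; rewrite mxE mul0r.
apply/colP => i; rewrite mxE; apply/eqP; rewrite -sqrf_eq0 expr2.
by rewrite (psumr_eq0P _ uu0) // => j _; exact: sqr_ge0.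
Qed.

Lemma dot_col_mx (R : realType) (m n : nat) (u : 'cV[R]_m) (v : 'cV[R]_n) w :
  dot (col_mx u v) w = dot u (usubmx w) + dot v (dsubmx w).
Proof.
rewrite /dot big_split_ord; congr (_ + _); apply: eq_bigr => i _.
  by rewrite col_mxEu mxE.
by rewrite col_mxEd mxE.
Qed.

(** The squared length of [dot v v *: u - dot u v *: v] is [dot v v] times the difference of the two
    sides. *)
Lemma cauchy_schwarz (R : realType) (n : nat) (u v : 'cV[R]_n) :
  v != 0 -> dot u v ^+ 2 <= dot u u * dot v v.
Proof.
rewrite -dot_eq0 => vv0.
have vv_gt0 : 0 < dot v v by rewrite lt_neqAle eq_sym vv0 dot_ge0.
have := dot_ge0 (dot v v *: u - dot u v *: v).
have lin z : dot (dot v v *: u - dot u v *: v) z =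
    dot v v * dot u z - dot u v * dot v z.
  by rewrite dotDl dotNl !dotZl.
rewrite lin ![dot _ (_ + _)]dotC !lin [dot v u]dotC => H.
rewrite -subr_ge0 -(pmulr_rge0 _ vv_gt0); apply: le_trans H _.
by rewrite le_eqVlt; apply/orP; left; apply/eqP; ring.
Qed.

(** * Minimal norm under two linear constraints, and its Gram matrix *)

(** Bounding the squared distance to [z] by the cost gap yields optimality and uniqueness at
    once. *)
Lemma kkt_min_norm (R : realType) (n : nat) (a1 a2 : 'cV[R]_n)
    (b1 b2 l1 l2 : R) (z := - (l1 *: a1 + l2 *: a2)) :
  lcp2 (dot a1 a1) (dot a1 a2) (dot a2 a2) b1 b2 l1 l2 ->
  [/\ dot a1 z <= b1, dot a2 z <= b2 &
      forall y, dot a1 y <= b1 -> dot a2 y <= b2 ->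
        dot (y - z) (y - z) <= dot y y - dot z z].
Proof.
have zE y : dot z y = - (l1 * dot a1 y + l2 * dot a2 y).
  by rewrite /z dotNl dotDl !dotZl.
move=> [[l10 l20] w1 w2 c1 c2].
have a1z : dot a1 z = - (dot a1 a1 * l1 + dot a1 a2 * l2).
  by rewrite dotC zE [dot a2 a1]dotC; ring.
have a2z : dot a2 z = - (dot a1 a2 * l1 + dot a2 a2 * l2).
  by rewrite dotC zE; ring.
split=> [||y y1 y2]; [by rewrite a1z; lra | by rewrite a2z; lra |].
have yzE : dot (y - z) (y - z) = dot y y - 2 * dot z y + dot z z.
  have yz w : dot (y - z) w = dot y w - dot z w.
    by rewrite dotDl dotNl.
  by rewrite yz ![dot _ (y - z)]dotC !yz [dot y z]dotC; ring.
(* Feasibility of [y] and nonnegative multipliers give [dot z y >= - (l1 * b1 + l2 * b2)], and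
   complementarity makes the right side equal to [dot z z]. *)
have zz : dot z z <= dot z y.
  have := ler_wpM2l l10 y1; have := ler_wpM2l l20 y2.
  rewrite !zE a1z a2z; lra.
rewrite yzE; lra.
Qed.

(** The entry -1 of the relaxation variable adds [dot q q] to the Gram determinant of [p] and [q],
    which is nonnegative by Cauchy-Schwarz. Thus [p] may vanish or be parallel to [q]. *)
Lemma gram_det_gt0 (R : realType) (m : nat) (p q : 'cV[R]_m)
    (a1 := col_mx p (- 1)%:M : 'cV[R]_(m + 1))
    (a2 := col_mx (- q) 0 : 'cV[R]_(m + 1)) :
  q != 0 -> 0 < dot a1 a1 /\ 0 < dot a1 a1 * dot a2 a2 - dot a1 a2 ^+ 2.
Proof.
move=> q0.
have a11 : dot a1 a1 = dot p p + 1.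
  by rewrite dot_col_mx col_mxKu col_mxKd /dot big_ord1 !mxE mulrNN mulr1.
have dot01 (w : 'cV[R]_1) : dot w 0 = 0.
  by rewrite /dot big1 // => i _; rewrite mxE mulr0.
have a12 : dot a1 a2 = - dot p q.
  by rewrite dot_col_mx col_mxKu col_mxKd dot01 addr0 dotC dotNl dotC.
have a22 : dot a2 a2 = dot q q.
  by rewrite dot_col_mx col_mxKu col_mxKd dot01 addr0 dotNl dotC dotNl opprK.
have qq_gt0 : 0 < dot q q by rewrite lt_neqAle eq_sym dot_eq0 q0 dot_ge0.
rewrite a11 a12 a22 sqrrN; split; first by rewrite ltr_wpDl ?dot_ge0.
by rewrite mulrDl mul1r addrAC ltr_wpDl // subr_ge0 cauchy_schwarz.
Qed.

Lemma locally_lipschitz_dot (R : realType) (E : normedModType R) (A : set E)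
    (n : nat) (G H : E -> 'cV[R]_n) :
  locally_lipschitz A G -> locally_lipschitz A H ->
  locally_lipschitz A (fun x => dot (G x) (H x)).
Proof.
move=> /locally_lipschitz_mxP GA /locally_lipschitz_mxP HA.
by apply: locally_lipschitz_sum => i; exact: locally_lipschitzM.
Qed.

Lemma locally_lipschitz_col_mx (R : realType) (E : normedModType R) (A : set E)
    (m n p : nat) (G : E -> 'M[R]_(m, p)) (H : E -> 'M[R]_(n, p)) :
  locally_lipschitz A G -> locally_lipschitz A H ->
  locally_lipschitz A (fun x => col_mx (G x) (H x)).
Proof.
move=> /locally_lipschitz_mxP GA /locally_lipschitz_mxP HA.
apply/locally_lipschitz_mxP => i j; case: (split_ordP i) => k ->.
  by apply: (eq_locally_lipschitz _ (GA k j)) => x _; rewrite col_mxEu.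
by apply: (eq_locally_lipschitz _ (HA k j)) => x _; rewrite col_mxEd.
Qed.

Lemma qp_feasibleE (R : realType) (n m : nat) (f : 'cV[R]_n -> 'cV[R]_n)
    (g : 'cV[R]_n -> 'M[R]_(n, m)) (V h : 'cV[R]_n -> R) (alpha : R -> R)
    (c : R) x z :
  qp_feasible f g V h alpha c x z <->
  dot (col_mx (Lg g V x)^T (- 1)%:M) z <= - (Lf f V x + c * V x) /\
  dot (col_mx (- (Lg g h x)^T) 0) z <= Lf f h x + alpha (h x).
Proof.
rewrite !dot_col_mx dotNl -!dotE !trmxK tr_scalar_mx trmx0 mul_scalar_mx mul0mx.
rewrite !mxE mulN1r addr0 /qp_feasible /= !mxE.
by split=> -[H1 H2]; split; lra.
Qed.

(** * Existence, uniqueness and Lipschitz dependence of the minimizer *)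

Theorem theorem3 (R : realType) (n m : nat)
    (f : 'cV[R]_n -> 'cV[R]_n) (g : 'cV[R]_n -> 'M[R]_(n, m))
    (V h : 'cV[R]_n -> R) (D : set 'cV[R]_n)
    (a b : \bar R) (alpha : R -> R) (c : R) :
  locally_lipschitz setT f ->
  locally_lipschitz setT g ->
  is_clf f g V ->
  locally_lipschitz setT (deriv_row V) ->
  0 < c ->
  locally_lipschitz_zcbf f g setT D h a b alpha ->
  (forall x, D x -> Lg g h x != 0) ->
  (forall x, D x -> exists! z, qp_solution f g V h alpha c x z) /\
  (forall ustar : 'cV[R]_n -> 'cV[R]_(m + 1),
     (forall x, D x -> qp_solution f g V h alpha c x (ustar x)) ->
     locally_lipschitz D ustar).
Proof.
move=> fT gT [C1V _ _ _] dVT _ [[C1h _ _ hD _] alphaK dhD] Lgh0.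
pose a1 x : 'cV[R]_(m + 1) := col_mx (Lg g V x)^T (- 1)%:M.
pose a2 x : 'cV[R]_(m + 1) := col_mx (- (Lg g h x)^T) 0.
pose b1 x := - (Lf f V x + c * V x).
pose b2 x := Lf f h x + alpha (h x).
have gram x : D x -> 0 < dot (a1 x) (a1 x) /\
    0 < dot (a1 x) (a1 x) * dot (a2 x) (a2 x) - dot (a1 x) (a2 x) ^+ 2.
  by move=> Dx; apply: gram_det_gt0; rewrite trmx_eq0 Lgh0.
pose lcp x (l : R * R) := lcp2 (dot (a1 x) (a1 x)) (dot (a1 x) (a2 x))
  (dot (a2 x) (a2 x)) (b1 x) (b2 x) l.1 l.2.
(* Choice needs a value at every state; off [D] it is the default [(0, 0)]. *)
have /choice[l lP] x : exists l, D x -> lcp x l.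
  have [Dx|nDx] := pselect (D x); last by exists (0, 0).
  have [p0 det0] := gram x Dx.
  by have [l1 [l2 l12]] := lcp2_exists (b1 x) (b2 x) p0 det0; exists (l1, l2).
pose zstar x := - ((l x).1 *: a1 x + (l x).2 *: a2 x).
have zstar_sol x : D x -> qp_solution f g V h alpha c x (zstar x).
  move=> Dx; have [z1 z2 zmin] := kkt_min_norm (lP x Dx).
  split=> [|y]; first by apply/qp_feasibleE.
  move=> /qp_feasibleE[y1 y2]; rewrite /qp_cost !dotE -subr_ge0.
  by apply: le_trans (zmin y y1 y2); exact: dot_ge0.
have zstar_uniq x z : D x -> qp_solution f g V h alpha c x z -> zstar x = z.
  move=> Dx [zf zopt]; have [_ _ zmin] := kkt_min_norm (lP x Dx).
  have [y1 y2] := (qp_feasibleE f g V h alpha c x z).1 zf.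
  have le0 := zmin z y1 y2.
  have := zopt _ (zstar_sol x Dx).1; rewrite /qp_cost !dotE => opt.
  apply/esym/eqP; rewrite -subr_eq0 -dot_eq0 eq_le dot_ge0 andbT.
  by rewrite (le_trans le0) // subr_le0.
split=> [x Dx|ustar usol].
  by exists (zstar x); split=> [|z]; [exact: zstar_sol | exact: zstar_uniq].
(* By uniqueness any selection of solutions agrees on [D] with the one built from the
   multipliers. *)
apply: (eq_locally_lipschitz (G := zstar)).
  by move=> x; rewrite inE => Dx; apply: zstar_uniq => //; exact: usol.
have fD := locally_lipschitzS (subsetT D) fT.
have gD := locally_lipschitzS (subsetT D) gT.
have dVD := locally_lipschitzS (subsetT D) dVT.
have LfD W : locally_lipschitz D (deriv_row W) -> locally_lipschitz D (Lf f W).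
  move=> WD.
  exact: (locally_lipschitz_mxP _ _).1 (locally_lipschitz_mulmx WD fD) 0 0.
have LgD W : locally_lipschitz D (deriv_row W) ->
    locally_lipschitz D (fun x => (Lg g W x)^T).
  move=> /locally_lipschitz_mulmx /(_ gD)/locally_lipschitz_mxP LgW.
  apply/locally_lipschitz_mxP => i j.
  by apply: (eq_locally_lipschitz _ (LgW j i)) => x _; rewrite [RHS]mxE.
have a1D : locally_lipschitz D a1.
  apply: locally_lipschitz_col_mx; first exact: LgD.
  exact: locally_lipschitz_cst.
have a2D : locally_lipschitz D a2.
  apply: locally_lipschitz_col_mx; last exact: locally_lipschitz_cst.
  apply/locally_lipschitz_mxP => i j.
  apply: (eq_locally_lipschitz (G := fun x => - (Lg g h x)^T i j)).
    by move=> x _; rewrite [RHS]mxE.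
  apply: locally_lipschitzN.
  exact: (locally_lipschitz_mxP _ _).1 (LgD h dhD) i j.
have b1D : locally_lipschitz D b1.
  apply: locally_lipschitzN; apply: locally_lipschitzD; first exact: LfD.
  apply: locally_lipschitzM; first exact: locally_lipschitz_cst.
  exact: cont_diff_locally_lipschitz.
have b2D : locally_lipschitz D b2.
  apply: locally_lipschitzD; first exact: LfD.
  (* [hD] keeps [h] on [D] inside the interval where [alpha] is locally Lipschitz. *)
  apply: (locally_lipschitz_comp hD) alphaK.
  exact: cont_diff_locally_lipschitz.
have [l1D l2D] := lcp2_locally_lipschitz (locally_lipschitz_dot a1D a1D)
  (locally_lipschitz_dot a1D a2D) (locally_lipschitz_dot a2D a2D) b1D b2D
  (fun x Dx => (gram x Dx).1) (fun x Dx => (gram x Dx).2) lP.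
apply/locally_lipschitz_mxP => i j.
apply: (eq_locally_lipschitz
  (G := fun x => - ((l x).1 * a1 x i j + (l x).2 * a2 x i j))).
  by move=> x _; rewrite !mxE.
have a1ij := (locally_lipschitz_mxP _ _).1 a1D i j.
have a2ij := (locally_lipschitz_mxP _ _).1 a2D i j.
by apply: locally_lipschitzN; apply: locally_lipschitzD;
  exact: locally_lipschitzM.
Qed.
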